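(* Let $\{\lambda^\nu\}\subset(0,\infty)$ and $\{\beta^\nu\}\subset(0,1)$ be sequences such that $\lambda^\nu\searrow0$ and $\limsup_{\nu\to\infty}\beta^\nu<1$. Let $\{x^\nu\}\subset\mathbb{R}^n$ be a sequence such that $\operatorname{dist}(-\nabla s_{\lambda^\nu,\beta^\nu}(x^\nu),N_C(x^\nu))\searrow0$, and suppose that $x^\nu\to x$, where $F_i(x)\in D$ and $F_i$ is well-behaved for all $i\in\{1,\dots,p\}$. Then the point $x$ is AM-stationary. Furthermore, if BCQ$^+$ is satisfied at $x$, then $x$ is M-stationary.
   Context: Setting: $f:\mathbb{R}^n\to\mathbb{R}$ and $G,H:\mathbb{R}^n\to\mathbb{R}^p$ are smooth, $C\subseteq\mathbb{R}^n$ is nonempty, closed and convex; the problem is to minimize $f(x)$ over $x\in C$ subject to $G(x)\ge0$, $H(x)\ge0$, $\langle G(x),H(x)\rangle=0$, and its solution set is assumed nonempty. $F_i=(G_i,H_i):\mathbb{R}^n\to\mathbb{R}^2$ with Jacobian $JF_i(x)\in\mathbb{R}^{2\times n}$ (rows $\nabla G_i(x)^\top,\nabla H_i(x)^\top$). $D=\{z\in\mathbb{R}^2:z_1,z_2\ge0,\ z_1z_2=0\}$; $x$ is feasible iff $x\in C$ and $F_i(x)\in D$ for all $i$. Limiting normal cone of $D$ at $z\in D$: $N_D(z)=\{0\}\times\mathbb{R}$ if $z_1>0$; $\mathbb{R}\times\{0\}$ if $z_2>0$; $N_D((0,0))=\{y:y_1\le0,y_2\le0\}\cup D$. $N_C(x)$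 is the normal cone of the convex set $C$ at $x$ (empty if $x\notin C$, with distance to the empty set equal to $+\infty$). $a^\nu\searrow0$ means decreasing (nonincreasing) convergence to $0$. For $\beta\in(0,1)$, $$r_\beta(z)=\begin{cases}\frac{1}{2(1-\beta)}\|z\|^2&\text{if }z_1\le0,z_2\le0\\ \frac{(z_1+z_2)^2}{2\beta(2-\beta)}-\frac{\|z\|^2}{2\beta}&\text{if }(1-\beta)z_1\le z_2\le\frac{z_1}{1-\beta}\\ \frac{1}{2(1-\beta)}\min\{z_1,z_2\}^2&\text{otherwise,}\end{cases}$$ which is continuously differentiable, and $s_{\lambda,\beta}(x)=f(x)+\frac1\lambda\sum_{i=1}^pr_\beta(F_i(x))$. Well-behaved: $F_i$ is well-behaved if there is $\xi>0$ such that for every $x\in\mathbb{R}^n$, $F_i(x)\notin\{z:\|z\|\le\xi,\ z_1>0,\ z_2>0\}$. M-stationary: a feasible $x$ is M-stationary if there exist $y_i\in N_D(F_i(x))$, $i=1,\dots,p$, with $0\in\nabla f(x)+\sum_{i=1}^pJF_i(x)^\top y_i+N_C(x)$. AM-stationary: a feasible $x$ is AM-stationary if there exist sequences $x^\nu\in\mathbb{R}^n$, $y_i^\nu,z_i^\nu\in\mathbb{R}^2$ ($i=1,\dots,p$) such that $\operatorname{dist}(-\nabla f(x^\nu)-\sum_{i=1}^pJF_i(x^\nu)^\top y_i^\nu,\,N_C(x^\nu))\to0$, $(x^\nu,z_i^\nu)\to(x,F_i(x))$, and $y_i^\nu\in N_D(z_i^\nu)$ (so $z_i^\nu\in D$)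 for all $i$ and $\nu$. BCQ$^+$ holds at a feasible $x$ if whenever $y_i=(y_i^G,y_i^H)\in N_D(F_i(x))$, $i=1,\dots,p$, satisfy $0\in\sum_{i=1}^pJF_i(x)^\top y_i+N_C(x)$, then for each $i\in\{1,\dots,p\}$: ($G_i$ is constant or $y_i^G=0$) and ($H_i$ is constant or $y_i^H=0$). *)

(* Defs.v *)
From HB Require Import structures.
From mathcomp Require Import all_boot all_order all_algebra.
From mathcomp Require Import all_classical all_reals all_analysis.

Set Implicit Arguments.
Unset Strict Implicit.
Unset Printing Implicit Defensive.

Import Order.TTheory GRing.Theory Num.Theory.
Import numFieldNormedType.Exports.

Local Open Scope classical_set_scope.
Local Open Scope ring_scope.

(* Points of R^n are row vectors. MathComp-Analysis norms matrices by the
   maximum norm, which induces the right topology on R^n; everything metric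
   below (distances, the ball of well-behavedness) uses the Euclidean norm. *)

Section Euclidean.
Context {R : realType} {n : nat}.
Implicit Types (u v x : 'rV[R]_n) (A C : set 'rV[R]_n) (f : 'rV[R]_n -> R).

Definition dotv u v : R := \sum_j u 0 j * v 0 j.

Definition enorm u : R := Num.sqrt (dotv u u).

(* The infimum of the empty set in \bar R is +oo, so dist v set0 = +oo. *)
Definition dist v A : \bar R := ereal_inf [set (enorm (v - a))%:E | a in A].

Definition grad f x : 'rV[R]_n := \row_j 'D_(delta_mx 0 j) f x.

Definition smooth f : Prop :=
  (forall x, differentiable f x) /\ continuous (grad f).

Definition smooth_map (m : nat) (g : 'rV[R]_n -> 'rV[R]_m) : Prop :=
  forall i, smooth (fun x => g x 0 i).

Definition normal_cone C x : set 'rV[R]_n :=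
  [set v : 'rV[R]_n | C x /\ forall y, C y -> dotv v (y - x) <= 0].

End Euclidean.

Section Plane.
Context {R : realType}.
Implicit Types (z y : 'rV[R]_2) (beta : R).

Definition Dset : set 'rV[R]_2 :=
  [set z | [/\ 0 <= z 0 0, 0 <= z 0 1 & z 0 0 * z 0 1 = 0]].

(* Limiting normal cone of Dset, empty at the points outside Dset. *)
Definition normal_cone_D z : set 'rV[R]_2 :=
  [set y : 'rV[R]_2 | Dset z /\
    (if 0 < z 0 0 then y 0 0 = 0
     else if 0 < z 0 1 then y 0 1 = 0
     else (y 0 0 <= 0 /\ y 0 1 <= 0) \/ Dset y)].

(* The first two regions meet only at the origin, where both formulas
   give 0, so the order of the tests is immaterial. *)
Definition r_pen beta z : R :=
  if (z 0 0 <= 0) && (z 0 1 <= 0) then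
    enorm z ^+ 2 / (2 * (1 - beta))
  else if ((1 - beta) * z 0 0 <= z 0 1) && (z 0 1 <= z 0 0 / (1 - beta)) then
    (z 0 0 + z 0 1) ^+ 2 / (2 * beta * (2 - beta)) - enorm z ^+ 2 / (2 * beta)
  else
    Num.min (z 0 0) (z 0 1) ^+ 2 / (2 * (1 - beta)).

End Plane.

Section Problem.
Context {R : realType} {n p : nat}.
Implicit Types (f : 'rV[R]_n -> R) (G H : 'rV[R]_n -> 'rV[R]_p).
Implicit Types (C : set 'rV[R]_n) (x : 'rV[R]_n).

Definition Fi G H (i : 'I_p) x : 'rV[R]_2 :=
  \row_(k < 2) (if k == 0 then G x 0 i else H x 0 i).

(* The library Jacobian 'J acts on row vectors: it is the n x 2 transpose of
   the matrix with rows grad G_i and grad H_i. *)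
Definition JFi G H (i : 'I_p) x : 'M[R]_(2, n) := ('J (Fi G H i) x)^T.

(* The row-vector form of \sum_i JF_i(x)^T y_i. *)
Definition multiplier_sum G H x (y : 'I_p -> 'rV[R]_2) : 'rV[R]_n :=
  \sum_i y i *m JFi G H i x.

Definition feasible G H C x : Prop := C x /\ forall i, Dset (Fi G H i x).

Definition solutions f G H C : set 'rV[R]_n :=
  [set x | feasible G H C x /\ forall x', feasible G H C x' -> f x <= f x'].

Definition s_pen f G H (lambda beta : R) x : R :=
  f x + lambda^-1 * \sum_i r_pen beta (Fi G H i x).

Definition well_behaved G H (i : 'I_p) : Prop :=
  exists2 xi : R, 0 < xi &
    forall x, ~ [/\ enorm (Fi G H i x) <= xi,
                    0 < Fi G H i x 0 0 & 0 < Fi G H i x 0 1].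

Definition M_stationary f G H C x : Prop :=
  feasible G H C x /\
  exists2 y : 'I_p -> 'rV[R]_2,
    forall i, normal_cone_D (Fi G H i x) (y i) &
    exists2 v, normal_cone C x v & grad f x + multiplier_sum G H x y + v = 0.

Definition AM_stationary f G H C x : Prop :=
  feasible G H C x /\
  exists (x_ : nat -> 'rV[R]_n) (y_ z_ : nat -> 'I_p -> 'rV[R]_2),
    [/\ (fun nu => dist (- grad f (x_ nu) - multiplier_sum G H (x_ nu) (y_ nu))
                        (normal_cone C (x_ nu))) @ \oo --> 0%E,
        x_ @ \oo --> x,
        forall i, (fun nu => z_ nu i) @ \oo --> Fi G H i x &
        forall nu i, normal_cone_D (z_ nu i) (y_ nu i)].

Definition constant_comp (g : 'rV[R]_n -> 'rV[R]_p) (i : 'I_p) : Prop :=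
  exists c : R, forall x, g x 0 i = c.

Definition BCQplus G H C x : Prop :=
  forall y : 'I_p -> 'rV[R]_2,
    (forall i, normal_cone_D (Fi G H i x) (y i)) ->
    (exists2 v, normal_cone C x v & multiplier_sum G H x y + v = 0) ->
    forall i, (constant_comp G i \/ y i 0 0 = 0) /\
              (constant_comp H i \/ y i 0 1 = 0).

End Problem.

(* Main.v *)
Require Import Defs.
From HB Require Import structures.
From mathcomp Require Import all_boot all_order all_algebra.
From mathcomp Require Import all_classical all_reals all_analysis.
From mathcomp Require Import ring.

Set Implicit Arguments.
Unset Strict Implicit.
Unset Printing Implicit Defensive.

Import Order.TTheory GRing.Theory Num.Theory.
Import numFieldNormedType.Exports.

Local Open Scope classical_set_scope.
Local Open Scope ring_scope.

(* The multipliers are y_i^nu = (1/lambda^nu) grad r_beta(F_i(x^nu)), and one may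
   take z_i^nu = F_i(x) for all nu: close to the axes, or close to the origin
   but off the open positive quadrant (well-behavedness), r_beta is a quadratic
   penalty whose gradient lies in N_D(F_i(x)). The bound limsup beta^nu < 1 makes
   the neighbourhood uniform in nu.
   For M-stationarity, N_D(z) is contained in N_D(F_i(x)) for z near F_i(x), so
   only the boundedness of the multipliers is at stake. Erase the components of
   constant constraints, scale the multipliers by t = 1/(1 + their l1-norm), and
   pass to the limit along an ultrafilter: the limits satisfy
   t0 grad f(x) + sum_i JF_i(x)^T w_i + v = 0 and t0 + |w|_1 = 1. If t0 = 0, then
   BCQ+ gives w = 0, which is absurd; otherwise divide by t0. *)

(** * Derivatives of compositions and of the squared negative part *)

Lemma is_derive_comp_diff (R : numFieldType) (V : normedModType R)
    (g : V -> R) (phi : R -> R) (x v : V) (d : R) :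
  differentiable g x -> is_derive (g x) 1 phi d ->
  is_derive x v (phi \o g) (d * 'D_v g x).
Proof.
move=> dg [dphi <-].
have dphi' : differentiable phi (g x) by exact/derivable1_diffP.
have dcomp : differentiable (phi \o g) x by exact: differentiable_comp.
apply: DeriveDef; first exact: diff_derivable.
rewrite deriveE// diff_comp//= diff1E// derive1E -(deriveE v dg).
by rewrite /GRing.scale /= mulrC.
Qed.

(** Only [t = 0] needs an estimate: there the difference quotient at [h] is bounded by [|h|].
    Elsewhere the function is locally a square or zero. *)
Lemma is_derive_sqr_min0 (R : realFieldType) (t : R) :
  is_derive t 1 (fun s => Num.min s 0 ^+ 2) (2 * Num.min t 0).
Proof.
have [t0|t0|->] := ltgtP t 0.
- have -> : 2 * t = t *: (1 : R) + t *: (1 : R).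
    by rewrite /GRing.scale /=; ring.
  apply: (@near_eq_is_derive R R R (id * id) _ t 1).
  near=> s; rewrite /= min_l ?expr2//.
  by apply/ltW; near: s; exact: lt_nbhsl.
- rewrite mulr0.
  apply: (@near_eq_is_derive R R R (cst 0) _ t 1).
  near=> s; rewrite /= min_r ?expr0n//.
  by apply/ltW; near: s; exact: lt_nbhsr.
- rewrite mulr0.
  have cvg0 : h^-1 *:
      (Num.min (h *: (1 : R) + 0) 0 ^+ 2 - Num.min (0 : R) 0 ^+ 2)
      @[h --> 0^'] --> (0 : R).
    apply/cvgrPdist_le => e e0; near=> h.
    rewrite minxx expr0n subr0 addr0 sub0r normrN.
    rewrite /GRing.scale /= mulr1 normrM normfV ler_pdivrMl; last first.
      by rewrite normr_gt0; near: h; exact: nbhs_dnbhs_neq.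
    rewrite normrX expr2 ler_pM//.
      by rewrite /Num.min; case: ifP; rewrite ?normr0.
    have he : `|h| <= e by near: h; exact: dnbhs0_le.
    by rewrite /Num.min; case: ifP; rewrite ?normr0// ltW.
  apply: DeriveDef; first by apply/cvg_ex; exists 0; exact: cvg0.
  exact: cvg_lim cvg0.
Unshelve. all: by end_near. Qed.

(** * Local quadratic forms of the penalty and their gradients *)

Section penalty.
Context {R : realType}.
Implicit Types (z : 'rV[R]_2) (b : R).

Lemma enorm2_sqr z : enorm z ^+ 2 = z 0 0 ^+ 2 + z 0 1 ^+ 2.
Proof.
have zE : dotv z z = z 0 0 ^+ 2 + z 0 1 ^+ 2.
  rewrite /dotv big_ord_recl big_ord1 -!expr2; congr (_ + z 0 _ ^+ 2).
  exact/val_inj.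
by rewrite /enorm sqr_sqrtr zE// addr_ge0 ?sqr_ge0.
Qed.

(** If some coordinate is positive, the other one is nonpositive. This rules out the middle region
    and makes the nonpositive coordinate the minimum. *)
Lemma r_pen_off_quadrant b z : 0 < b < 1 -> ~ (0 < z 0 0 /\ 0 < z 0 1) ->
  r_pen b z =
    (Num.min (z 0 0) 0 ^+ 2 + Num.min (z 0 1) 0 ^+ 2) / (2 * (1 - b)).
Proof.
move=> /andP[b0 b1] zN; rewrite /r_pen enorm2_sqr.
have b1' : 0 < 1 - b by rewrite subr_gt0.
case: ifPn => [/andP[z0 z1]|]; first by rewrite !min_l.
rewrite negb_and -!ltNge => z01.
have [[z0 z1]|[z0 z1]] : 0 < z 0 0 /\ z 0 1 <= 0 \/ z 0 0 <= 0 /\ 0 < z 0 1.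
- case: (leP (z 0 0) 0) z01 zN => /= z0; case: (leP (z 0 1) 0) => //= z1 _ zN.
  + by right.
  + by left.
  + by case: zN.
- rewrite ifF; last first.
    apply/negP => /andP[]; rewrite leNgt => /negP + _; apply.
    by apply: (le_lt_trans z1); rewrite mulr_gt0.
  rewrite (min_r (ltW z0)) expr0n add0r (min_l z1) min_r//.
  by rewrite (le_trans z1)// ltW.
- rewrite ifF; last first.
    apply/negP => /andP[_]; rewrite ler_pdivlMr// leNgt => /negP; apply.
    by apply: (le_lt_trans z0); rewrite mulr_gt0.
  rewrite (min_r (ltW z1)) expr0n addr0 (min_l z0) min_l//.
  by rewrite (le_trans z0)// ltW.
Qed.

(** The point lies strictly below the middle region, whose lower edge has slope [1 - b < 1]; hence
    the minimum is [z 0 1], whatever its sign. *)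
Lemma r_pen_near_axis0 b z : 0 < b < 1 -> 0 < z 0 0 ->
  z 0 1 < (1 - b) * z 0 0 -> r_pen b z = z 0 1 ^+ 2 / (2 * (1 - b)).
Proof.
move=> /andP[b0 b1] z0 z1; rewrite /r_pen ifF; last by rewrite leNgt z0.
rewrite ifF; last by rewrite leNgt z1.
rewrite min_r// ltW// (lt_trans z1)// gtr_pMl// ltrBlDr.
by rewrite ltrDl.
Qed.

Lemma r_pen_near_axis1 b z : 0 < b < 1 -> 0 < z 0 1 ->
  z 0 0 < (1 - b) * z 0 1 -> r_pen b z = z 0 0 ^+ 2 / (2 * (1 - b)).
Proof.
move=> /andP[b0 b1] z1 z0; have b1' : 0 < 1 - b by rewrite subr_gt0.
rewrite /r_pen ifF; last by rewrite andbC leNgt z1.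
rewrite ifF; last by rewrite andbC ler_pdivlMr// mulrC leNgt z0.
rewrite min_l// ltW// (lt_trans z0)// gtr_pMl// ltrBlDr.
by rewrite ltrDl.
Qed.

(* Near a point [z0] of [Dset], off the open positive quadrant if [z0 = 0], the
   penalty [r_pen b] coincides with the following function of [z]. *)
Definition pen_model b z0 z : R :=
  (if 0 < z0 0 0 then z 0 1 ^+ 2
   else if 0 < z0 0 1 then z 0 0 ^+ 2
   else Num.min (z 0 0) 0 ^+ 2 + Num.min (z 0 1) 0 ^+ 2) / (2 * (1 - b)).

(** The gradient of [pen_model b z0] at [z]; the 2 from differentiating squares cancels the 2 in the
    denominator. *)
Definition pen_grad b z0 z : 'rV[R]_2 :=
  (1 - b)^-1 *: \row_(k < 2)
    (if 0 < z0 0 0 then (if k == 0 then 0 else z 0 1)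
     else if 0 < z0 0 1 then (if k == 0 then z 0 0 else 0)
     else Num.min (z 0 k) 0).

Lemma normal_cone_DZ z0 (c : R) y : 0 <= c ->
  normal_cone_D z0 y -> normal_cone_D z0 (c *: y).
Proof.
move=> c0 [Dz0 zy]; split=> //; rewrite !mxE; move: zy.
case: ifPn => _ => [->|]; first by rewrite mulr0.
case: ifPn => _ => [->|]; first by rewrite mulr0.
move=> [[y0 y1]|[y0 y1 y01]]; [left|right; split]; rewrite ?mxE.
- by rewrite !mulr_ge0_le0.
- exact: mulr_ge0.
- exact: mulr_ge0.
- by rewrite mulrACA y01 mulr0.
Qed.

(** On an axis the model ignores the positive coordinate of [z0], so that component of the gradient
    is zero. At the origin both components are negative parts, which gives the nonpositive
    quadrant. *)
Lemma pen_grad_normal b z0 z : b < 1 -> Dset z0 ->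
  normal_cone_D z0 (pen_grad b z0 z).
Proof.
move=> b1 Dz0; apply: normal_cone_DZ; first by rewrite invr_ge0 subr_ge0 ltW.
split=> //; rewrite !mxE/=.
case: (0 < z0 0 0); first by [].
case: (0 < z0 0 1); first by [].
by left; rewrite !ge_min !lexx !orbT.
Qed.

End penalty.

(** * Gradient of the penalized objective *)

Section gradient.
Context {R : realType} {n p : nat}.
Implicit Types (f : 'rV[R]_n -> R) (G H : 'rV[R]_n -> 'rV[R]_p).
Implicit Types (u v x : 'rV[R]_n) (i : 'I_p) (y : 'I_p -> 'rV[R]_2).

Lemma Fi0 G H i u : Fi G H i u 0 0 = G u 0 i.
Proof. by rewrite mxE. Qed.

Lemma Fi1 G H i u : Fi G H i u 0 1 = H u 0 i.
Proof. by rewrite mxE. Qed.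

Lemma JFiE G H i u (k : 'I_2) (j : 'I_n) : smooth_map G -> smooth_map H ->
  JFi G H i u k j =
    'D_(delta_mx 0 j) (fun w => if k == 0 then G w 0 i else H w 0 i) u.
Proof.
move=> sG sH.
have dF : differentiable (Fi G H i) u.
  (* Splitting along the two basis vectors reduces differentiability to that of the scalar
     components. *)
  have -> : Fi G H i = (fun w => G w 0 i *: delta_mx 0 0) +
                       (fun w => H w 0 i *: delta_mx 0 1).
    apply/funext => w; apply/rowP => l; rewrite !mxE.
    case: l => -[|[|//]] lt2 /=; first by rewrite mulr1 mulr0 addr0.
    by rewrite mulr0 mulr1 add0r.
  apply: differentiableD; apply: differentiableZl.
    exact: (sG i).1.
  exact: (sH i).1.
rewrite /JFi /jacobian !mxE -deriveE// derive_mx; last exact: diff_derivable.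
rewrite mxE; congr ('D_ _ _ _); apply/funext => w.
by rewrite mxE.
Qed.

Lemma multiplier_sumE G H u y (j : 'I_n) : smooth_map G -> smooth_map H ->
  multiplier_sum G H u y 0 j =
    \sum_i (y i 0 0 * grad (fun w => G w 0 i) u 0 j +
            y i 0 1 * grad (fun w => H w 0 i) u 0 j).
Proof.
move=> sG sH; rewrite /multiplier_sum summxE; apply: eq_bigr => i _.
rewrite mxE big_ord_recl big_ord1 !JFiE// !mxE.
by congr (_ + y i 0 _ * _); exact/val_inj.
Qed.

Lemma is_derive_pen_model G H (b : R) (z0 : 'rV[R]_2) i u v : b < 1 ->
  smooth_map G -> smooth_map H ->
  is_derive u v (fun w => pen_model b z0 (Fi G H i w))
    (pen_grad b z0 (Fi G H i u) 0 0 * 'D_v (fun w => G w 0 i) u +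
     pen_grad b z0 (Fi G H i u) 0 1 * 'D_v (fun w => H w 0 i) u).
Proof.
move=> b1 sG sH; have dG := (sG i).1 u; have dH := (sH i).1 u.
have b1' : 1 - b != 0 by rewrite subr_eq0 eq_sym lt_eqF.
have -> : (fun w => pen_model b z0 (Fi G H i w)) = fun w =>
    (if 0 < z0 0 0 then H w 0 i ^+ 2 else if 0 < z0 0 1 then G w 0 i ^+ 2
     else Num.min (G w 0 i) 0 ^+ 2 + Num.min (H w 0 i) 0 ^+ 2) / (2 * (1 - b)).
  by apply/funext => w; rewrite /pen_model Fi0 Fi1.
rewrite /pen_grad !mxE /=.
have sqrD (t : R) : is_derive t (1 : R) (fun s : R => s ^+ 2) (2 * t).
  have -> : (fun s : R => s ^+ 2) = id ^+ 2 by rewrite exprfctE.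
  apply: is_derive_eq.
  by rewrite /GRing.scale /= mulr1 expr1.
have scal (phi : 'rV[R]_n -> R) d e : is_derive u v phi d ->
    (2 * (1 - b))^-1 * d = e ->
    is_derive u v (fun w => phi w / (2 * (1 - b))) e.
  move=> dphi <-.
  have -> : (fun w => phi w / (2 * (1 - b))) = (2 * (1 - b))^-1 *: phi.
    by apply/funext => w; rewrite /= mulrC.
  exact: is_deriveZ.
have compG phi d := @is_derive_comp_diff _ _ _ phi u v d dG.
have compH phi d := @is_derive_comp_diff _ _ _ phi u v d dH.
case: ifPn => _.
  apply: (scal _ _ _ (compH _ _ (sqrD _))).
  by field.
case: ifPn => _.
  apply: (scal _ _ _ (compG _ _ (sqrD _))).
  by field.
apply: (scal (_ + _)).
  apply: is_deriveD.
    exact: (compG _ _ (is_derive_sqr_min0 _)).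
  exact: (compH _ _ (is_derive_sqr_min0 _)).
by field.
Qed.

(** Derivatives are local, so each penalty term may be replaced by its model on a neighbourhood of
    [u]; the base point [z0 i] may differ from term to term. *)
Lemma grad_s_pen f G H (l b : R) (z0 : 'I_p -> 'rV[R]_2) u :
  smooth f -> smooth_map G -> smooth_map H -> b < 1 ->
  (forall i, \forall w \near u,
     pen_model b (z0 i) (Fi G H i w) = r_pen b (Fi G H i w)) ->
  grad (s_pen f G H l b) u = grad f u +
    multiplier_sum G H u (fun i => l^-1 *: pen_grad b (z0 i) (Fi G H i u)).
Proof.
move=> sf sG sH b1 model; apply/rowP => j.
rewrite mxE [RHS]mxE multiplier_sumE// [grad f u 0 j]mxE.
set v := delta_mx 0 j.
have -> : s_pen f G H l b =
    f + l^-1 *: (\sum_i (fun w => r_pen b (Fi G H i w))).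
  apply/funext => w; rewrite /s_pen /=; congr (_ + _ * _).
  by rewrite fct_sumE.
have df : is_derive u v f ('D_v f u).
  by apply: derivableP; apply: diff_derivable; exact: sf.1.
have dr i := near_eq_is_derive (model i)
  (is_derive_pen_model (z0 i) i u v b1 sG sH).
rewrite (@derive_val _ _ _ _ _ _ _
  (is_deriveD df (is_deriveZ l^-1 (is_derive_sum dr)))).
congr (_ + _); rewrite /GRing.scale /= mulr_sumr; apply: eq_bigr => i _.
rewrite mulrDr !mulrA; by congr (_ * _ + _ * _); rewrite [RHS]mxE.
Qed.

(** The quantifier over [b] stands inside the neighbourhood because the parameter changes along the
    sequence: one neighbourhood of [x] must serve every [b <= bm]. *)
Lemma r_pen_local G H i x (bm : R) :
  smooth_map G -> smooth_map H -> well_behaved G H i ->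
  Dset (Fi G H i x) -> bm < 1 ->
  \forall w \near x, forall b, 0 < b -> b <= bm ->
    pen_model b (Fi G H i x) (Fi G H i w) = r_pen b (Fi G H i w).
Proof.
move=> sG sH [xi xi0 wb] [x0 x1 x01] bm1.
have cG : {for x, continuous (fun w => G w 0 i)}.
  by apply: differentiable_continuous; exact: (sG i).1.
have cH : {for x, continuous (fun w => H w 0 i)}.
  by apply: differentiable_continuous; exact: (sH i).1.
rewrite /pen_model; move: x0 x1 x01; rewrite !Fi0 !Fi1 => x0 x1 x01.
have [G0|G0] := ltP 0 (G x 0 i).
  have H0 : H x 0 i = 0 by move/eqP: x01; rewrite mulf_eq0 gt_eqF//= => /eqP.
  (* Positivity persists near [x], and [1 - bm <= 1 - b] turns it into the condition of
     [r_pen_near_axis0] for all [b <= bm] at once. *)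
  have c : 0 < (1 - bm) * G x 0 i - H x 0 i.
    by rewrite H0 subr0 mulr_gt0// subr_gt0.
  have cc : {for x, continuous (fun w => (1 - bm) * G w 0 i - H w 0 i)}.
    exact: (cvgB (cvgM (cvg_cst _) cG) cH).
  near=> w => b b0 bbm.
  have Gw : 0 < G w 0 i by near: w; apply: cvgr_gt; [exact: cG|].
  have b1 : b < 1 by exact: le_lt_trans bm1.
  rewrite r_pen_near_axis0 ?b0 ?Fi0 ?Fi1//.
  apply: (@lt_le_trans _ _ ((1 - bm) * G w 0 i)).
    by rewrite -subr_gt0; near: w; apply: cvgr_gt; [exact: cc|].
  by rewrite ler_pM2r// lerB.
have [H0|H0] := ltP 0 (H x 0 i).
  have G0' : G x 0 i = 0 by apply/eqP; rewrite eq_le G0 x0.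
  have c : 0 < (1 - bm) * H x 0 i - G x 0 i.
    by rewrite G0' subr0 mulr_gt0// subr_gt0.
  have cc : {for x, continuous (fun w => (1 - bm) * H w 0 i - G w 0 i)}.
    exact: (cvgB (cvgM (cvg_cst _) cH) cG).
  near=> w => b b0 bbm.
  have Hw : 0 < H w 0 i by near: w; apply: cvgr_gt; [exact: cH|].
  have b1 : b < 1 by exact: le_lt_trans bm1.
  rewrite r_pen_near_axis1 ?b0 ?Fi0 ?Fi1//.
  apply: (@lt_le_trans _ _ ((1 - bm) * H w 0 i)).
    by rewrite -subr_gt0; near: w; apply: cvgr_gt; [exact: cc|].
  by rewrite ler_pM2r// lerB.
have Gx0 : G x 0 i = 0 by apply/eqP; rewrite eq_le G0 x0.
have Hx0 : H x 0 i = 0 by apply/eqP; rewrite eq_le H0 x1.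
(* The squared norm is continuous and vanishes at [x], so [Fi G H i w] enters the ball of radius
   [xi], where well-behavedness excludes the open positive quadrant. *)
have cn : {for x, continuous (fun w => G w 0 i ^+ 2 + H w 0 i ^+ 2)}.
  exact: (cvgD (cvgM cG cG) (cvgM cH cH)).
near=> w => b b0 bbm.
rewrite r_pen_off_quadrant ?b0 ?(le_lt_trans bbm)// ?Fi0 ?Fi1//.
move=> [Gw Hw]; apply: (wb w); rewrite Fi0 Fi1; split=> //.
rewrite -(@ler_pXn2r _ 2)// ?nnegrE ?sqrtr_ge0 ?(ltW xi0)//.
rewrite enorm2_sqr Fi0 Fi1; apply/ltW; near: w.
by apply: cvgr_lt; [exact: cn|rewrite Gx0 Hx0 expr0n addr0 exprn_gt0].
Unshelve. all: by end_near. Qed.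

End gradient.

(** * Limits of finite sums and compactness along ultrafilters *)

Lemma cvg_sumr (R : realType) (T : Type) (F : set_system T) (I : Type)
    (r : seq I) (g : I -> T -> R) (l : I -> R) : Filter F ->
  (forall i, g i t @[t --> F] --> l i) ->
  \sum_(i <- r) g i t @[t --> F] --> \sum_(i <- r) l i.
Proof. by move=> FF gl; apply: cvg_big => //; exact: add_continuous. Qed.

Lemma ultra_bounded_cvg (R : realType) (T : Type) (U : set_system T) (m : nat)
    (u : T -> 'rV[R]_m) (M : R) :
  UltraFilter U -> (forall a j, `|u a 0 j| <= M) ->
  exists l : 'rV[R]_m, u @ U --> l.
Proof.
move=> UU uM.
have cK := @rV_compact R m (fun=> `[- M, M]%classic)
  (fun=> @segment_compact _ _ _).
have [|l [_ cl]] := cK (u @ U) _.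
  by apply: (@filterE _ U) => a j; rewrite /= in_itv /= -ler_norml; exact: uM.
 exists l => B nB.
(* Were [B] not in the ultrafilter, its complement would be, and the cluster point [l] would force
   [B] to meet its own complement. *)
have [//|UBC] := in_ultra_setVsetC (u @^-1` B) UU.
by have [b [nBb /nBb]] := cl (~` B) B UBC nB.
Qed.

(** * Approximate projections when the distance tends to zero *)

Section distance.
Context {R : realType} {n : nat}.
Implicit Types (v : 'rV[R]_n) (A : set 'rV[R]_n).

Lemma ler_coord_enorm v j : `|v 0 j| <= enorm v.
Proof.
rewrite /enorm -sqrtr_sqr ler_wsqrtr// /dotv (bigD1 j)//= -expr2 lerDl.
by apply: sumr_ge0 => k _; rewrite -expr2 sqr_ge0.
Qed.

Lemma dist_cvg0_witness (a : nat -> 'rV[R]_n) (A : nat -> set 'rV[R]_n) :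
  (fun nu => dist (a nu) (A nu)) @ \oo --> 0%E ->
  exists v : nat -> 'rV[R]_n, (\forall nu \near \oo, A nu (v nu)) /\
    forall j, (a nu - v nu) 0 j @[nu --> \oo] --> 0.
Proof.
move=> /fine_cvgP[fin d0].
(* The slack [harmonic nu] avoids asking that the infimum be attained. Where the distance is
   infinite the choice is arbitrary, which concerns only finitely many indices. *)
have /choice[v vP] nu : exists w, dist (a nu) (A nu) \is a fin_num ->
    A nu w /\ enorm (a nu - w) < fine (dist (a nu) (A nu)) + harmonic nu.
  have [dfin|_] := boolP (dist (a nu) (A nu) \is a fin_num); last by exists 0.
  have h0 : 0 < harmonic nu :> R by rewrite invr_gt0.
  have [_ [w Aw <-] wd] := lb_ereal_inf_adherent h0 dfin.
  by exists w => _; split=> //; rewrite -lte_fin EFinD fineK.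
exists v; split; first by apply: filterS fin => nu /vP[].
move=> j; apply/cvgrPdist_lt => e e0.
have dh : fine (dist (a nu) (A nu)) + harmonic nu @[nu --> \oo] --> 0.
  by rewrite -[0](addr0 0); apply: cvgD => //; exact: cvg_harmonic.
near=> nu.
have /vP[_ vnu] : dist (a nu) (A nu) \is a fin_num by near: nu.
rewrite sub0r normrN (le_lt_trans (ler_coord_enorm _ _))// (lt_trans vnu)//.
by near: nu; apply: cvgr_lt; [exact: dh|].
Unshelve. all: by end_near. Qed.

End distance.

(** * Closedness and local inclusion of the limiting normal cones of [Dset] *)

Section plane_cone.
Context {R : realType}.
Implicit Types (z y : 'rV[R]_2).

Lemma closed_normal_cone_D z : closed (normal_cone_D z).
Proof.
have coordP k (A : set R) : closed A -> closed [set y : 'rV[R]_2 | A (y 0 k)].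
  by move=> cA; apply: preimage_closed => // y _; exact: coord_continuous.
have mulC : continuous (fun y : 'rV[R]_2 => y 0 0 * y 0 1).
  move=> y; have cy k := @coord_continuous R 1 2 0 k y.
  exact: (cvgM (cy 0) (cy 1)).
rewrite /normal_cone_D; have [Dz|Dz] := pselect (Dset z); last first.
  rewrite (_ : [set _ | _] = set0); first exact: closed0.
  by apply/seteqP; split=> y // [].
have dropD (P : 'rV[R]_2 -> Prop) :
    closed [set y | P y] -> closed [set y | Dset z /\ P y].
  by congr closed; apply/seteqP; split=> y //= [].
apply: dropD; case: (0 < z 0 0).
  exact: (coordP 0 [set s | s = 0] (@closed_eq R 0)).
case: (0 < z 0 1).
  exact: (coordP 1 [set s | s = 0] (@closed_eq R 0)).
have := closedU
  (closedI (coordP 0 _ (@closed_le R 0)) (coordP 1 _ (@closed_le R 0)))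
  (closedI (closedI (coordP 0 _ (@closed_ge R 0)) (coordP 1 _ (@closed_ge R 0)))
    (preimage_closed (fun y _ => mulC y) (@closed_eq R 0))).
congr closed; apply/seteqP; split=> y.
  by move=> [|[[]]]; [left|right].
by move=> [|[]]; [left|right].
Qed.

(** A positive coordinate of [z] stays positive nearby. At the origin, the cone contains both
    coordinate lines, hence the cones at all other points of [Dset]. *)
Lemma normal_cone_D_near z : Dset z ->
  \forall z' \near z, normal_cone_D z' `<=` normal_cone_D z.
Proof.
move=> Dz; have cz k : {for z, continuous (fun z' : 'rV[R]_2 => z' 0 k)}.
  exact: coord_continuous.
have [z0|z0] := boolP (0 < z 0 0).
  near=> z' => y [_]; rewrite ifT; last first.
    by near: z'; apply: cvgr_gt; [exact: cz|].
  by split=> //; rewrite z0.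
have [z1|z1] := boolP (0 < z 0 1).
  near=> z' => y [[_ _ z'01]].
  have z'1 : 0 < z' 0 1 by near: z'; apply: cvgr_gt; [exact: cz|].
  have z'0 : z' 0 0 = 0.
    by move/eqP: z'01; rewrite mulf_eq0 (gt_eqF z'1) orbF => /eqP.
  by rewrite z'0 ltxx z'1 => y1; split=> //; rewrite (negbTE z0) z1.
near=> z' => y [_ yz']; split=> //; rewrite (negbTE z0) (negbTE z1); move: yz'.
case: ifPn => _ => [y0|].
  (* A vector on a coordinate line lies in the nonpositive quadrant or in [Dset], according to the
     sign of its other component. *)
  have [y1|y1] := leP (y 0 1) 0; first by left; rewrite y0.
  by right; split; rewrite ?y0 ?mul0r// ltW.
case: ifPn => _ // y1.
have [y0|y0] := leP (y 0 0) 0; first by left; rewrite y1.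
by right; split; rewrite ?y1 ?mulr0// ltW.
Unshelve. all: by end_near. Qed.

(** Each piece of the cone is stable under zeroing coordinates; this allows the multipliers of
    constant constraints to be dropped. *)
Lemma normal_cone_D_erase z y (P : pred 'I_2) :
  normal_cone_D z y -> normal_cone_D z (\row_k (if P k then 0 else y 0 k)).
Proof.
move=> [Dz zy]; split=> //; rewrite !mxE; move: zy.
case: ifPn => _ => [->|]; first by rewrite if_same.
case: ifPn => _ => [->|]; first by rewrite if_same.
move=> [[y0 y1]|[y0 y1 y01]]; [left|right; split; rewrite ?mxE].
- by split; case: ifP.
- by case: ifP.
- by case: ifP.
- by case: ifP; rewrite ?mul0r//; case: ifP; rewrite ?mulr0.
Qed.

End plane_cone.

Variant ord2_spec : 'I_2 -> Prop := Ord2_0 : ord2_spec 0 | Ord2_1 : ord2_spec 1.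

Lemma ord2P (k : 'I_2) : ord2_spec k.
Proof.
case: k => -[|[|//]] k2.
  by rewrite (_ : Ordinal k2 = 0); [constructor|exact/val_inj].
by rewrite (_ : Ordinal k2 = 1); [constructor|exact/val_inj].
Qed.

(** * Passage to the limit in the stationarity conditions *)

Section stationarity.
Context {R : realType} {n p : nat}.
Implicit Types (f : 'rV[R]_n -> R) (G H : 'rV[R]_n -> 'rV[R]_p).
Implicit Types (C : set 'rV[R]_n) (u v x : 'rV[R]_n).

Lemma grad_constant_comp (g : 'rV[R]_n -> 'rV[R]_p) (i : 'I_p) u :
  constant_comp g i -> grad (fun w => g w 0 i) u = 0.
Proof.
move=> [c gc]; apply/rowP => j; rewrite !mxE.
by rewrite (_ : (fun w => _) = cst c) ?derive_cst//; apply/funext.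
Qed.

Lemma multiplier_sumZ G H u (c : R) (y : 'I_p -> 'rV[R]_2) :
  multiplier_sum G H u (fun i => c *: y i) = c *: multiplier_sum G H u y.
Proof.
rewrite /multiplier_sum scaler_sumr; apply: eq_bigr => i _.
by rewrite scalemxAl.
Qed.

Lemma normal_coneZ C x (c : R) v :
  0 <= c -> normal_cone C x v -> normal_cone C x (c *: v).
Proof.
move=> c0 [Cx xv]; split=> // y Cy.
have -> : dotv (c *: v) (y - x) = c * dotv v (y - x).
  by rewrite /dotv mulr_sumr; apply: eq_bigr => j _; rewrite !mxE mulrA.
by rewrite mulr_ge0_le0// xv.
Qed.

Lemma grad_cvg (T : Type) (F : set_system T) (x_ : T -> 'rV[R]_n) f x j :
  Filter F -> smooth f -> x_ @ F --> x ->
  grad f (x_ a) 0 j @[a --> F] --> grad f x 0 j.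
Proof.
move=> FF [_ cf] xF.
exact: (cvg_comp _ _ (cvg_comp _ _ xF (cf x)) (@coord_continuous _ _ _ 0 j _)).
Qed.

Lemma multiplier_sum_cvg (T : Type) (F : set_system T) (x_ : T -> 'rV[R]_n)
    (w : T -> 'I_p -> 'rV[R]_2) G H x (w0 : 'I_p -> 'rV[R]_2) j :
  Filter F -> smooth_map G -> smooth_map H -> x_ @ F --> x ->
  (forall i k, w a i 0 k @[a --> F] --> w0 i 0 k) ->
  multiplier_sum G H (x_ a) (w a) 0 j @[a --> F] -->
  multiplier_sum G H x w0 0 j.
Proof.
move=> FF sG sH xF wF.
have -> : (fun a => multiplier_sum G H (x_ a) (w a) 0 j) = fun a => \sum_i
    (w a i 0 0 * grad (fun u => G u 0 i) (x_ a) 0 j +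
     w a i 0 1 * grad (fun u => H u 0 i) (x_ a) 0 j).
  by apply/funext => a; exact: multiplier_sumE.
rewrite (multiplier_sumE x w0 j sG sH).
apply: cvg_sumr => i.
have cG := grad_cvg (j := j) FF (sG i) xF.
have cH := grad_cvg (j := j) FF (sH i) xF.
exact: (cvgD (cvgM (wF i 0) cG) (cvgM (wF i 1) cH)).
Qed.

(** A pure limit argument in which the penalty no longer enters. *)
Lemma AM_stationary_BCQplus f G H C x :
  smooth f -> smooth_map G -> smooth_map H ->
  AM_stationary f G H C x -> BCQplus G H C x -> M_stationary f G H C x.
Proof.
move=> sf sG sH [feas [x_ [y_ [z_ [dist0 xx zx yz]]]]] bcq; split=> //.
have [Cx Dx] := feas.
(* BCQ+ says nothing about these components, but their gradients vanish, so erasing them leaves the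
   multiplier sum unchanged. *)
pose cst i (k : 'I_2) :=
  if k == 0 then `[< constant_comp G i >] else `[< constant_comp H i >].
pose y nu i : 'rV[R]_2 := \row_k (if cst i k then 0 else y_ nu i 0 k).
have ysum nu : multiplier_sum G H (x_ nu) (y nu) =
    multiplier_sum G H (x_ nu) (y_ nu).
  apply/rowP => j; rewrite !multiplier_sumE//; apply: eq_bigr => i _.
  congr (_ + _); rewrite mxE /cst /=; case: asboolP => //.
    by move=> /grad_constant_comp ->; rewrite !mxE !mulr0.
  by move=> /grad_constant_comp ->; rewrite !mxE !mulr0.
have yN : \forall nu \near \oo, forall i, normal_cone_D (Fi G H i x) (y nu i).
  apply: filter_forall => i.
  have zi : \forall nu \near \oo,
      normal_cone_D (z_ nu i) `<=` normal_cone_D (Fi G H i x).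
    exact: zx i _ (normal_cone_D_near (Dx i)).
  apply: filterS zi => nu zi.
  exact: zi _ (normal_cone_D_erase (cst i) (yz nu i)).
have [v [vN av]] := dist_cvg0_witness dist0.
pose s nu := \sum_i (`|y nu i 0 0| + `|y nu i 0 1|).
have s_ge0 nu : 0 <= s nu by apply: sumr_ge0 => i _; rewrite addr_ge0.
pose t nu := (1 + s nu)^-1.
have s1_gt0 nu : 0 < 1 + s nu by rewrite ltr_pwDl.
have t_gt0 nu : 0 < t nu by rewrite invr_gt0.
have ts1 nu : t nu * (1 + s nu) = 1 by rewrite mulVf// gt_eqF.
pose w nu i := t nu *: y nu i.
(* In this form the normalization passes to the limit, with [t0] as the limit of [t]. *)
have tE nu : t nu = 1 - \sum_i (`|w nu i 0 0| + `|w nu i 0 1|).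
  have -> : \sum_i (`|w nu i 0 0| + `|w nu i 0 1|) = t nu * s nu.
    rewrite mulr_sumr; apply: eq_bigr => i _.
    by rewrite /w !mxE !normrM (gtr0_norm (t_gt0 nu)) mulrDr.
  by rewrite -[X in X - _](ts1 nu) mulrDr mulr1 addrK.
have w_le1 nu i k : `|w nu i 0 k| <= 1.
  rewrite /w mxE normrM (gtr0_norm (t_gt0 nu)) -(ts1 nu) ler_pM2l//.
  apply: (@le_trans _ _ (s nu)); last by rewrite lerDr.
  rewrite /s (bigD1 i)//= -[leLHS]addr0 lerD//; last first.
    by apply: sumr_ge0 => l _; rewrite addr_ge0.
  by case/ord2P: k; rewrite ?lerDl ?lerDr.
(* A single ultrafilter finer than [\oo] makes all the bounded families converge together, in place
   of successive subsequences. *)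
have [U [UU ooU]] := @ultraFilterLemma _ (\oo : set_system nat) _.
have /choice[w0 ww0] i : exists l : 'rV[R]_2, w nu i @[nu --> U] --> l.
  exact: ultra_bounded_cvg (w_le1^~ i).
have ww0k i k : w nu i 0 k @[nu --> U] --> w0 i 0 k.
  exact: (cvg_comp _ _ (ww0 i) (@coord_continuous _ _ _ 0 k _)).
pose t0 := 1 - \sum_i (`|w0 i 0 0| + `|w0 i 0 1|).
have tt0 : t nu @[nu --> U] --> t0.
  rewrite (_ : t = fun nu => 1 - \sum_i (`|w nu i 0 0| + `|w nu i 0 1|));
    last exact/funext.
  apply: cvgB; first exact: cvg_cst.
  apply: cvg_sumr => i; apply: cvgD; exact: (cvg_norm (ww0k _ _)).
have xU : x_ @ U --> x by move=> B /xx; exact: ooU.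
pose v0 := - (t0 *: grad f x + multiplier_sum G H x w0).
(* The normal vectors [v nu] may be unbounded. Their scaled versions converge because they are the
   scaled stationarity expression up to an error tending to zero. *)
have tv j : t nu * v nu 0 j @[nu --> U] --> v0 0 j.
  have -> : (fun nu => t nu * v nu 0 j) = fun nu =>
      - (t nu * grad f (x_ nu) 0 j + multiplier_sum G H (x_ nu) (w nu) 0 j)
      - t nu *
        (- grad f (x_ nu) - multiplier_sum G H (x_ nu) (y_ nu) - v nu) 0 j.
    apply/funext => nu; rewrite multiplier_sumZ ysum.
    rewrite -[LHS]/(t nu * v nu 0 j).
    move: (grad f (x_ nu)) (multiplier_sum _ _ _ _) => a b.
    by rewrite !mxE; ring.
  have -> : v0 0 j =
      - (t0 * grad f x 0 j + multiplier_sum G H x w0 0 j) - t0 * 0.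
    by rewrite mulr0 subr0 !mxE.
  apply: cvgB.
    apply: cvgN; apply: cvgD; last exact: multiplier_sum_cvg.
    by apply: cvgM => //; exact: grad_cvg.
  apply: cvgM => // B /(av j); exact: ooU.
(* For each fixed [c] in [C], the normality inequality survives scaling by [t nu > 0] and passes to
   the limit. *)
have v0N : normal_cone C x v0.
  split=> // c Cc.
  have cvg_dot : \sum_j t nu * v nu 0 j * (c - x_ nu) 0 j @[nu --> U] -->
      \sum_j v0 0 j * (c - x) 0 j.
    apply: cvg_sumr => j; apply: cvgM; first exact: tv.
    have -> : (fun nu => (c - x_ nu) 0 j) = fun nu => c 0 j - x_ nu 0 j.
      by apply/funext => nu; rewrite !mxE.
    rewrite !mxE; apply: cvgB; first exact: cvg_cst.
    exact: (cvg_comp _ _ xU (@coord_continuous _ _ _ 0 j _)).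
  apply: (cvgr_to_le cvg_dot); apply: filterS (ooU _ vN) => nu [_ /(_ _ Cc)].
  under eq_bigr do rewrite -mulrA.
  by rewrite -mulr_sumr pmulr_rle0.
have w0N i : normal_cone_D (Fi G H i x) (w0 i).
  apply: (closed_cvg _ (@closed_normal_cone_D _ _) _ _ (ww0 i)).
  apply: filterS (ooU _ yN) => nu /(_ i); apply: normal_cone_DZ; exact: ltW.
have t0_ge0 : 0 <= t0.
  by apply: (cvgr_to_ge tt0); apply: filterE => nu; exact: ltW.
have [t00|t0_neq0] := eqVneq t0 0.
  (* The erased components vanish along the whole sequence, hence in the limit; BCQ+ handles the
     remaining ones. *)
  have w00 i k : cst i k -> w0 i 0 k = 0.
    move=> cik; have wik0 : w nu i 0 k @[nu --> U] --> (0 : R).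
      rewrite (_ : (fun nu => w nu i 0 k) = fun=> 0); first exact: cvg_cst.
      by apply/funext => nu; rewrite !mxE cik mulr0.
    exact: (cvg_unique _ (ww0k i k) wik0).
  have bw : exists2 v, normal_cone C x v & multiplier_sum G H x w0 + v = 0.
    by exists v0 => //; rewrite /v0 t00 scale0r add0r subrr.
  have w0_eq0 i k : w0 i 0 k = 0.
    have [bG bH] := bcq w0 w0N bw i.
    case/ord2P: k; [case: bG => // ?|case: bH => // ?].
      by apply: w00; apply/asboolP.
    by apply: w00; apply/asboolP.
  move: t00; rewrite /t0 big1 ?subr0 => [/eqP|i _]; first by rewrite oner_eq0.
  by rewrite !w0_eq0 normr0 addr0.
have t0_gt0 : 0 < t0 by rewrite lt_neqAle eq_sym t0_neq0.
exists (fun i => t0^-1 *: w0 i).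
  by move=> i; apply: normal_cone_DZ => //; rewrite invr_ge0.
exists (t0^-1 *: v0); first by apply: normal_coneZ => //; rewrite invr_ge0.
rewrite multiplier_sumZ /v0 scalerN scalerDr scalerA mulVf// scale1r.
by rewrite subrr.
Qed.

Lemma AM_stationary_penalty f G H C (lambda beta : nat -> R)
    (x_ : nat -> 'rV[R]_n) x :
  smooth f -> smooth_map G -> smooth_map H -> closed C ->
  (forall nu, 0 < lambda nu) -> (forall nu, 0 < beta nu < 1) ->
  (limn_esup (fun nu => (beta nu)%:E) < 1)%E ->
  (fun nu => dist (- grad (s_pen f G H (lambda nu) (beta nu)) (x_ nu))
                  (normal_cone C (x_ nu))) @ \oo --> 0%E ->
  x_ @ \oo --> x -> (forall i, Dset (Fi G H i x)) ->
  (forall i : 'I_p, well_behaved G H i) ->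
  AM_stationary f G H C x.
Proof.
move=> sf sG sH cC l0 b01 blim dist0 xx Dx wb.
have [bm bm1 bbm] : exists2 bm, bm < 1 & \forall nu \near \oo, beta nu <= bm.
  (* The limsup is the infimum of suprema over eventual sets, so one such set [V] already has
     supremum below 1. *)
  have [y [V ooV <-] supV] := ereal_inf_lt blim.
  have ub nu : V nu -> ((beta nu)%:E <= ereal_sup [set (beta k)%:E | k in V])%E.
    by move=> Vnu; apply: ereal_sup_ubound; exists nu.
  case: (ereal_sup _) supV ub => [r r1 ub|//|_ ub].
  - by exists r => //; apply: filterS ooV => nu /ub.
  - by exists 0 => //; apply: filterS ooV => nu /ub.
(* A finite distance forces a nonempty normal cone, so [x_ nu] eventually lies in the closed set
   [C]. *)
have Cx : C x.
  apply: (closed_cvg _ cC _ _ xx).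
  have /fine_cvgP[fin _] := dist0.
  apply: filterS fin => nu dfin.
  have [_ [u [Cu _] _] _] := lb_ereal_inf_adherent ltr01 dfin.
  exact: Cu.
have model : \forall nu \near \oo, forall i, \forall u \near x_ nu,
    pen_model (beta nu) (Fi G H i x) (Fi G H i u) =
    r_pen (beta nu) (Fi G H i u).
  apply: filter_forall => i.
  have loc : \forall nu \near \oo, \forall u \near x_ nu, forall b, 0 < b ->
      b <= bm -> pen_model b (Fi G H i x) (Fi G H i u) = r_pen b (Fi G H i u).
    (* Passing to the interior turns a neighbourhood of [x] into one of each nearby [x_ nu], as
       differentiating at [x_ nu] requires. *)
    exact: xx _ (nbhs_interior (r_pen_local sG sH (wb i) (Dx i) bm1)).
  apply: filterS2 bbm loc => nu bnu; apply: filterS => u; apply => //.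
  by have /andP[] := b01 nu.
split=> //; exists x_.
exists (fun nu i => (lambda nu)^-1 *:
  pen_grad (beta nu) (Fi G H i x) (Fi G H i (x_ nu))).
exists (fun _ i => Fi G H i x); split=> //.
(* The two distance sequences agree only from some index on, which suffices for the limit; the cone
   memberships below hold at every index. *)
- apply: cvg_trans dist0; apply: near_eq_cvg; apply: filterS model => nu mnu.
  rewrite (grad_s_pen _ sf sG sH _ mnu) ?opprD//.
  by have /andP[] := b01 nu.
- by move=> i; exact: cvg_cst.
- move=> nu i; apply: normal_cone_DZ; first by rewrite invr_ge0 ltW.
  by apply: pen_grad_normal => //; have /andP[] := b01 nu.
Qed.

End stationarity.

Theorem theorem4p10 (R : realType) (n p : nat)
    (f : 'rV[R]_n -> R) (G H : 'rV[R]_n -> 'rV[R]_p) (C : set 'rV[R]_n)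
    (smooth_f : smooth f) (smooth_G : smooth_map G) (smooth_H : smooth_map H)
    (C_nonempty : C !=set0) (C_closed : closed C) (C_convex : convex_set C)
    (solvable : solutions f G H C !=set0)
    (lambda beta : nat -> R)
    (lambda_gt0 : forall nu, 0 < lambda nu)
    (beta_itv : forall nu, 0 < beta nu < 1)
    (lambda_decr : nonincreasing_seq lambda)
    (lambda_to0 : lambda @ \oo --> 0)
    (beta_limsup : (limn_esup (fun nu => (beta nu)%:E) < 1)%E)
    (x_ : nat -> 'rV[R]_n)
    (dist_decr : nonincreasing_seq (fun nu =>
       dist (- grad (s_pen f G H (lambda nu) (beta nu)) (x_ nu))
            (normal_cone C (x_ nu))))
    (dist_to0 : (fun nu =>
       dist (- grad (s_pen f G H (lambda nu) (beta nu)) (x_ nu))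
            (normal_cone C (x_ nu))) @ \oo --> 0%E)
    (x : 'rV[R]_n)
    (x_cvg : x_ @ \oo --> x)
    (F_in_D : forall i, Dset (Fi G H i x))
    (F_well_behaved : forall i, well_behaved G H i) :
  AM_stationary f G H C x /\
  (BCQplus G H C x -> M_stationary f G H C x).
Proof.
have AM := AM_stationary_penalty smooth_f smooth_G smooth_H C_closed lambda_gt0
  beta_itv beta_limsup dist_to0 x_cvg F_in_D F_well_behaved.
split=> // bcq; exact: AM_stationary_BCQplus bcq.
Qed.
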